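(* Let $\mathbb{F}$ be a field, $X=\{x_1,\ldots,x_n\}$, and let $\varphi:\mathbb{F}\langle X\rangle\to\mathbb{F}\langle x,y\rangle$ be the $\mathbb{F}$-algebra homomorphism with $\varphi(x_i)=u_i+\overline{u_i}$ for $1\le i\le n$. Let $f\in\mathbb{F}\langle X\rangle$ and suppose $\varphi(f)=g'\cdot h'$ is a nontrivial factorization in $\mathbb{F}\langle x,y\rangle$ (i.e.\ $\deg g'>0$, $\deg h'>0$). Then there exist polynomials $g,h\in\mathbb{F}\langle X\rangle$ with $g,h\notin\mathbb{F}$ such that $g'=\varphi(g)$, $h'=\varphi(h)$ and $f=g\cdot h$.
   Context: Monomials in $\{x,y\}^*$ are ordered by $\prec$: $m_1\prec m_2$ if $\deg m_1<\deg m_2$, or $\deg m_1=\deg m_2$ and at the leftmost position where they differ $m_1$ has $y$ and $m_2$ has $x$. For $m\in\{x,y\}^*$, $d_x(m)$, $d_y(m)$ are the numbers of occurrences of $x$, $y$, and the imbalance is $i(m)=d_x(m)-d_y(m)$. A monomial $m$ is minimally balanced if $m\neq\epsilon$, $i(m)=0$ and every prefix $m'$ of $m$ with $m'\ne\epsilon$, $m'\neq m$ has $i(m')>0$. The minimally balanced monomials listed in increasing $\prec$-order are $u_1,u_2,\ldots$. For a monomial $w$, $\overline{w}$ is obtained by replacing every $x$ by $y$ and every $y$ by $x$. *)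

(* Defs.v *)
From HB Require Import structures.
From mathcomp Require Import all_boot all_order all_algebra.
From mathcomp Require Import finmap monalg.
From mathcomp Require Import zify.

Set Implicit Arguments.
Unset Strict Implicit.
Unset Printing Implicit Defensive.

Import GRing.Theory Num.Theory Order.TTheory.

Local Open Scope ring_scope.

Notation freealg R I := {malg R[{fmonom I}]}.

Section FreeAlgebra.
Variables (R : comNzRingType) (I : choiceType).

Definition var (i : I) : freealg R I := << fmu i >>.

(* [mmeasure] is one more than the degree, and zero at the zero polynomial,
   so [deg 0 = 0]. *)
Definition deg (g : freealg R I) : nat := (mmeasure (@fdeg I) g).-1.

Lemma malgC_comm (c : R) (g : freealg R I) : c%:MP * g = g * c%:MP.
Proof.
rewrite !malgM_def fgmulUg fgmulgU; apply: eq_bigr => k _.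
by rewrite mul1m mulm1 mulrC.
Qed.

End FreeAlgebra.

Section Substitution.
Variables (R : comNzRingType) (I J : choiceType) (v : I -> freealg R J).

Definition fmprod (m : {fmonom I}) : freealg R J := \prod_(i <- (m : seq I)) v i.

Lemma fmprod_mmorphism : mmorphism fmprod.
Proof.
by split=> [m1 m2|]; rewrite /fmprod ?fmM ?big_cat // fm1 big_nil.
Qed.

HB.instance Definition _ := monalg.isMultiplicative.Build _ _ fmprod
  fmprod_mmorphism.

Definition subst (f : freealg R I) : freealg R J :=
  mmap (@malgC {fmonom J} R) fmprod f.

HB.instance Definition _ := GRing.Additive.copy subst
  (mmap (@malgC {fmonom J} R) fmprod).

Lemma subst_multiplicative : multiplicative subst.
Proof.
exact: commr_mmap_is_multiplicative (fun g m m' => malgC_comm g@_m (fmprod m')).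
Qed.

HB.instance Definition _ :=
  GRing.isMultiplicative.Build _ _ subst subst_multiplicative.

Lemma subst_scalable : scalable subst.
Proof. by move=> c f; rewrite /subst mmapZ mul_malgC. Qed.

HB.instance Definition _ :=
  GRing.isScalable.Build _ _ _ _ subst subst_scalable.

Lemma subst_var (i : I) : subst (var R i) = v i.
Proof. by rewrite /subst mmapU /= mpolyC1E mul1r /fmprod fmU big_seq1. Qed.

(* Hence [subst] is the algebra homomorphism that maps each [var i] to [v i]. *)
Lemma subst_unique (psi : {lrmorphism freealg R I -> freealg R J}) :
  (forall i, psi (var R i) = v i) -> psi =1 subst.
Proof.
move=> psiE f; rewrite {1}[f]monalgE raddf_sum /subst mmapE.
apply: eq_bigr => m _.
have -> : << f@_m *g m >> = f@_m *: (<< m >> : freealg R I).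
  by apply/malgP => k; rewrite mcoeffZ !mcoeffU mulr_natr.
rewrite -[LHS]/(psi _) linearZ /= -mul_malgC; congr (_ * _).
have -> : << m >> = \prod_(i <- (m : seq I)) var R i.
  rewrite -[m in LHS]fmK; elim: (fmonom_val m) => [|i s IHs] /=.
    by rewrite big_nil -fmoneE.
  rewrite big_cons -IHs malgM_def fgmulUU mulr1.
  by congr << _ >>; apply: val_inj; rewrite [RHS]fmM fmU.
by rewrite rmorph_prod; apply: eq_bigr => i _; apply: psiE.
Qed.

End Substitution.

Variant letter := lx | ly.

Definition letter_isx (a : letter) : bool := if a is lx then true else false.
Definition letter_of (b : bool) : letter := if b then lx else ly.
Lemma letter_isxK : cancel letter_isx letter_of. Proof. by case. Qed.

HB.instance Definition _ := Countable.copy letter (can_type letter_isxK).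

Notation word := {fmonom letter}.

(* Lexicographic comparison with [y] before [x]; it is only ever applied to
   sequences of equal length. *)
Fixpoint lexlt (s t : seq letter) : bool :=
  match s, t with
  | a :: s', b :: t' => if a == b then lexlt s' t' else (a == ly) && (b == lx)
  | _, _ => false
  end.

Definition prec (m1 m2 : word) : bool :=
  (fdeg m1 < fdeg m2)%N || (fdeg m1 == fdeg m2) && lexlt m1 m2.

Definition imbalance (s : seq letter) : int :=
  (count_mem lx s)%:Z - (count_mem ly s)%:Z.

Definition min_balanced (m : word) : bool :=
  [&& m != mone, imbalance m == 0 &
      [forall k : 'I_(fdeg m), (0 < k)%N ==> (0 < imbalance (take k m))]].

Definition swap (a : letter) : letter := if a is lx then ly else lx.

Definition bar (m : word) : word := FMonom (map swap m).

(* The words of degree [d], in increasing order for [prec]. *)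
Fixpoint words (d : nat) : seq (seq letter) :=
  if d is d'.+1 then map (cons ly) (words d') ++ map (cons lx) (words d')
  else [:: [::]].

Definition min_balanced_le (d : nat) : seq word :=
  [seq m <- flatten [seq map (@FMonom letter) (words k) | k <- iota 0 d.+1]
  | min_balanced m].

(* Counting from 0.  Every positive even degree contains a minimally balanced
   word, so the first [i.+1] of them have degree at most [i.+1.*2].  The lemmas
   [u_increasing] and [u_enum] show that [u 0], [u 1], ... is the increasing
   enumeration of all minimally balanced words. *)
Definition u (i : nat) : word := nth mone (min_balanced_le i.+1.*2) i.

Lemma prec_trans : transitive prec.
Proof.
move=> [t] [s] [r]; rewrite /prec /fdeg /=.
case/orP=> [lt_st|/andP[/eqP eq_st lst]] /orP[lt_tr|/andP[/eqP eq_tr ltr]].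
- by rewrite (ltn_trans lt_st lt_tr).
- by rewrite -eq_tr lt_st.
- by rewrite eq_st lt_tr.
rewrite eq_st eq_tr eqxx ltnn /= {eq_st eq_tr}.
elim: s t r lst ltr => [|a s IHs] [|b t] [|c r] //=.
by case: a b c => [] [] [] //=; apply: IHs.
Qed.

Lemma prec_irr : irreflexive prec.
Proof.
by case=> s; rewrite /prec ltnn eqxx /=; elim: s => //= a s ->; rewrite eqxx.
Qed.

Lemma mem_words d s : (s \in words d) = (size s == d).
Proof.
elim: d s => [|d IHd] [|a s] //=; rewrite mem_cat.
  by apply/norP; split; apply/mapP; case.
have consK b : injective (@cons letter b) by move=> ? ? [].
rewrite eqSS -IHd; case: a; rewrite (mem_map (consK _)).
  by rewrite orb_idl // => /mapP[].
by rewrite orb_idr // => /mapP[].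
Qed.

Lemma words_sorted d :
  pairwise (fun s t => prec (FMonom s) (FMonom t)) (words d).
Proof.
elim: d => //= d IHd; rewrite pairwise_cat !pairwise_map.
apply/and3P; split.
- apply/allrelP => _ _ /mapP[s sd ->] /mapP[t td ->].
  move: sd td; rewrite !mem_words /prec /fdeg /= => /eqP-> /eqP->.
  by rewrite eqxx orbT.
- by apply: sub_pairwise IHd => s t /=; rewrite /prec /fdeg /= ltnS eqSS.
- by apply: sub_pairwise IHd => s t /=; rewrite /prec /fdeg /= ltnS eqSS.
Qed.

Lemma mem_min_balanced_le d m :
  (m \in min_balanced_le d) = (fdeg m <= d)%N && min_balanced m.
Proof.
rewrite mem_filter andbC; congr (_ && _).
apply/flatten_mapP/idP => [[k]|led].
  rewrite mem_iota /= add0n => lek /mapP[s]; rewrite mem_words => /eqP sz_s ->.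
  by rewrite /fdeg /= sz_s -ltnS.
exists (fdeg m); first by rewrite mem_iota.
by apply/mapP; exists (m : seq letter); rewrite ?mem_words ?fmK.
Qed.

Lemma min_balanced_leD d e : exists s,
  min_balanced_le (d + e) = min_balanced_le d ++ s.
Proof.
rewrite /min_balanced_le -addSn iotaD map_cat flatten_cat filter_cat.
by eexists.
Qed.

Lemma min_balanced_leS d : min_balanced_le d.+1 =
  min_balanced_le d ++ [seq m <- map (@FMonom letter) (words d.+1) | min_balanced m].
Proof.
rewrite /min_balanced_le -[in LHS]addn1 iotaD map_cat flatten_cat filter_cat.
by rewrite /= !cats0.
Qed.

Lemma min_balanced_le_sorted d : pairwise prec (min_balanced_le d).
Proof.
elim: d => [|d IHd]; first by rewrite /min_balanced_le /=; case: ifP.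
rewrite min_balanced_leS pairwise_cat IHd andTb.
apply/andP; split; last first.
  apply: pairwise_filter; rewrite pairwise_map; exact: words_sorted.
apply/allrelP => m1 m2; rewrite mem_min_balanced_le mem_filter.
case/andP=> le1 _ /andP[_ /mapP[s]]; rewrite mem_words /prec => /eqP es ->.
by rewrite {2 4}/fdeg /= es ltnS le1.
Qed.

Lemma min_balanced_xy k : (0 < k)%N ->
  min_balanced (FMonom (nseq k lx ++ nseq k ly)).
Proof.
move=> k0; apply/and3P; split.
- by rewrite -fdeg_eq0 /fdeg /= size_cat size_nseq; lia.
- by rewrite /imbalance !count_cat !count_nseq /=; lia.
apply/forallP=> -[j /=]; rewrite /fdeg /= size_cat !size_nseq => ltj.
apply/implyP=> j0; rewrite /imbalance take_cat size_nseq.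
case: ltnP => lejk.
  by rewrite (take_nseq _ (ltnW lejk)) !count_nseq /= mul1n mul0n subr0.
have lt_jk : (j - k < k)%N by lia.
rewrite (take_nseq _ (ltnW lt_jk)) !count_cat !count_nseq /=.
by rewrite !mul1n !mul0n addn0 add0n subr_gt0 ltz_nat.
Qed.

Lemma size_min_balanced_le i : (i <= size (min_balanced_le i.*2))%N.
Proof.
elim: i => // i IHi; rewrite doubleS !min_balanced_leS !size_cat -addnA.
rewrite -addn1 leq_add // addn_gt0; apply/orP; right.
rewrite -has_predT; apply/hasP.
exists (FMonom (nseq i.+1 lx ++ nseq i.+1 ly)) => //.
rewrite mem_filter min_balanced_xy // map_f // mem_words size_cat !size_nseq.
by apply/eqP; lia.
Qed.

Lemma uE i d : (i < size (min_balanced_le d))%N ->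
  u i = nth mone (min_balanced_le d) i.
Proof.
have Hi := size_min_balanced_le i.+1 => lti; rewrite /u.
have [led|/ltnW led] := leqP d i.+1.*2.
  by have [s] := min_balanced_leD d (i.+1.*2 - d);
     rewrite subnKC // => ->; rewrite nth_cat lti.
have [s] := min_balanced_leD i.+1.*2 (d - i.+1.*2).
by rewrite subnKC // => ->; rewrite nth_cat Hi.
Qed.

Lemma u_increasing i j : (i < j)%N -> prec (u i) (u j).
Proof.
have Hj := size_min_balanced_le j.+1 => ltij.
have Hi := ltn_trans ltij Hj.
rewrite (uE Hi) (uE Hj).
exact: (pairwiseP mone (min_balanced_le_sorted _)).
Qed.

Lemma u_enum (m : word) : min_balanced m <-> exists i, m = u i.
Proof.
split=> [bm|[i ->]]; last first.
  have := mem_nth mone (size_min_balanced_le i.+1).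
  by rewrite mem_min_balanced_le => /andP[].
have Hm : m \in min_balanced_le (fdeg m).
  by rewrite mem_min_balanced_le leqnn.
exists (index m (min_balanced_le (fdeg m))).
by rewrite (@uE _ (fdeg m)) ?index_mem // nth_index.
Qed.

Definition phi (F : fieldType) (n : nat) : freealg F 'I_n -> freealg F letter :=
  subst (fun i : 'I_n => << u i >> + << bar (u i) >>).

HB.instance Definition _ (F : fieldType) (n : nat) :=
  GRing.LRMorphism.copy (@phi F n)
    (subst (fun i : 'I_n => << u i >> + << bar (u i) >>)).

Lemma phi_var (F : fieldType) (n : nat) (i : 'I_n) :
  phi (var F i) = << u i >> + << bar (u i) >>.
Proof. exact: subst_var. Qed.

(* Main.v *)
From HB Require Import structures.
Require Import Defs.
From mathcomp Require Import all_boot all_order all_algebra.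
From mathcomp Require Import finmap monalg.
From mathcomp Require Import zify.

Set Implicit Arguments.
Unset Strict Implicit.
Unset Printing Implicit Defensive.

Import GRing.Theory Num.Theory Order.TTheory.

Local Open Scope ring_scope.

(** The swap [bar] fixes [phi f], so if [m1], [m2] are longest monomials of [g']
    and [h'], then [bar m1 * bar m2] occurs in [g' * h'] and hence [bar m1]
    occurs in [g'].  As [phi f] is balanced, [g'] is homogeneous for the
    imbalance, which is therefore zero: [g'] and [h'] are balanced.  Balanced
    words form the free monoid on the letters [u i] and [bar (u i)], and the
    triangular change of variables [u i := u i + bar (u i)] makes the image of
    [phi] the subalgebra generated by [n] of the free letters; counting the
    other letters shows that it contains the factors of its nonzero elements. *)

(** * Weights and extremal monomials of products *)

Lemma exists_max_in (T : eqType) (f : T -> int) (s : seq T) : s != [::] ->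
  exists2 x, x \in s & forall y, y \in s -> f y <= f x.
Proof.
elim: s => // a s IHs _; have [->|/IHs[x xs maxx]] := eqVneq s [::].
  by exists a; rewrite ?mem_head // => y; rewrite inE => /eqP->.
have [le_ax|lt_xa] := leP (f a) (f x).
  exists x => [|y]; first by rewrite inE xs orbT.
  by rewrite inE => /predU1P[->|/maxx].
exists a => [|y]; first exact: mem_head.
by rewrite inE => /predU1P[->|/maxx/le_trans->] //; apply: ltW.
Qed.

Lemma fmonom_inj (I : choiceType) (m1 m2 : {fmonom I}) :
  m1 = m2 :> seq I -> m1 = m2.
Proof. exact: val_inj. Qed.

Section Weight.
Variables (I : choiceType) (d : I -> int).

Definition weight (m : seq I) : int := \sum_(i <- m) d i.

Lemma weight_cat s t : weight (s ++ t) = weight s + weight t.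
Proof. exact: big_cat. Qed.

Lemma weightM (m1 m2 : {fmonom I}) :
  weight (mmul m1 m2 : {fmonom I}) = weight m1 + weight m2.
Proof. by rewrite fmM weight_cat. Qed.

End Weight.

Section LeadingMonomials.
Variables (R : idomainType) (I : choiceType).
Implicit Types (g h : freealg R I) (m : {fmonom I}).

Lemma exists_max_weight_size (d : I -> int) g : g != 0 ->
  exists2 m, m \in msupp g & forall m', m' \in msupp g ->
    weight d m' <= weight d m /\
    (weight d m' = weight d m -> (size m' <= size m)%N).
Proof.
move=> g0; have sg0 : (msupp g : seq _) != [::].
  apply: contraNneq g0 => sg; rewrite -msupp_eq0.
  by apply/eqP/fsetP => m; rewrite in_fset0 [LHS](_ : _ = (m \in [::])) // -sg.
have [m0 m0g max0] := exists_max_in (fun m : {fmonom I} => weight d m) sg0.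
pose s := [seq m : {fmonom I} <- msupp g | weight d m == weight d m0].
have s0 : s != [::].
  have: m0 \in s by rewrite mem_filter eqxx.
  by apply: contraTneq => ->.
have [m] := exists_max_in (fun m : {fmonom I} => (size m)%:Z) s0.
rewrite mem_filter => /andP[/eqP dm mg] maxm; exists m => // m' m'g.
rewrite dm; split; first exact: max0.
by move=> e; have := maxm m'; rewrite mem_filter e eqxx => /(_ m'g).
Qed.

(* Maximising first the weight and then the length makes the factorisation of
   the product monomial unique, because the free monoid is cancellative once
   the lengths of the factors are known. *)
Lemma msupp_mul_max (d : I -> int) g h : g != 0 -> h != 0 ->
  exists m1 m2, [/\ m1 \in msupp g, m2 \in msupp h,
    mmul m1 m2 \in msupp (g * h),
    forall m, m \in msupp g -> weight d m <= weight d m1 &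
    forall m, m \in msupp h -> weight d m <= weight d m2].
Proof.
move=> /(exists_max_weight_size d)[m1 m1g max1].
move=> /(exists_max_weight_size d)[m2 m2h max2].
exists m1, m2; split=> //; [|by move=> m /max1[]|by move=> m /max2[]].
have uniq_fact k1 k2 : k1 \in msupp g -> k2 \in msupp h ->
    mmul k1 k2 = mmul m1 m2 -> k1 = m1 /\ k2 = m2.
  move=> /max1[w1 s1] /max2[w2 s2] e.
  have ew : weight d k1 + weight d k2 = weight d m1 + weight d m2.
    by rewrite -!weightM e.
  have es : k1 ++ k2 = m1 ++ m2 by rewrite -!fmM e.
  have sz : (size k1 + size k2 = size m1 + size m2)%N by rewrite -!size_cat es.
  (* Neither weight exceeds its maximum and the sums agree, so both are maximal; only then do the
     bounds on the lengths apply, and the same argument fixes the lengths. *)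
  have {s1}s1 := s1 ltac:(lia); have {s2}s2 := s2 ltac:(lia).
  have sz1 : size k1 = size m1 by lia.
  have /eqP := es; rewrite eqseq_cat //.
  by case/andP=> /eqP/fmonom_inj-> /eqP/fmonom_inj->.
(* By [uniq_fact] only the pair [m1], [m2] contributes to this coefficient, which is thus a product
   of two nonzero scalars in a domain. *)
rewrite -mcoeff_neq0 mcoeffMl (big_fsetD1 m1) //= [X in _ + X]big1_seq ?addr0.
  rewrite (big_fsetD1 m2) //= eqxx mulr1n [X in _ + X]big1_seq ?addr0.
    by rewrite mulf_neq0 ?mcoeff_neq0.
  move=> k2 /= k2h; case: eqP => // e; move: k2h; rewrite in_fsetD1.
  by case/andP=> /eqP ne k2h; case: (uniq_fact m1 k2).
move=> k1 /= k1g; rewrite big1_seq // => k2 /= k2h; case: eqP => // e.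
move: k1g; rewrite in_fsetD1 => /andP[/eqP ne k1g].
by case: (uniq_fact k1 k2).
Qed.

Lemma weightN (d : I -> int) s : weight (fun i => - d i) s = - weight d s.
Proof. by rewrite /weight sumrN. Qed.

(** The largest weights of [g] and [h] add up to zero, and so do the smallest, obtained from the
    weight [- d]. Hence largest and smallest coincide in each factor. *)
Lemma homogeneous_factors (d : I -> int) g h : g != 0 -> h != 0 ->
  (forall m, m \in msupp (g * h) -> weight d m = 0) ->
  exists k, (forall m, m \in msupp g -> weight d m = k) /\
            (forall m, m \in msupp h -> weight d m = - k).
Proof.
move=> g0 h0 gh0.
have [a [c [ag cg /gh0 ac maxa maxc]]] := msupp_mul_max d g0 h0.
have [b [e [bg eg /gh0 be minb mine]]] := msupp_mul_max (fun i => - d i) g0 h0.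
rewrite weightM in ac; rewrite weightM in be.
have := maxa _ bg; have := maxc _ eg => ce ab.
exists (weight d a); split=> m mg.
  by have := maxa _ mg; have := minb _ mg; rewrite !weightN; lia.
by have := maxc _ mg; have := mine _ mg; rewrite !weightN; lia.
Qed.

End LeadingMonomials.

(** * Replacing letters by words *)

Section Encoding.
Variables (R : comNzRingType) (I J : choiceType) (w : I -> seq J).

Definition encode (m : {fmonom I}) : {fmonom J} :=
  FMonom (flatten (map w m)).

Definition encode_alg : freealg R I -> freealg R J :=
  subst (fun i => << FMonom (w i) >>).

HB.instance Definition _ := GRing.LRMorphism.copy encode_alg
    (subst (fun i => << FMonom (w i) >> : freealg R J)).

Lemma encode_algD : {morph encode_alg : p q / p + q}.
Proof. exact: raddfD. Qed.

Lemma encode_algM : {morph encode_alg : p q / p * q}.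
Proof. exact: rmorphM. Qed.

(** Each letter goes to a single word, so monomials go to monomials and the coefficients are carried
    along. *)
Lemma encode_algE p :
  encode_alg p = \sum_(m <- msupp p) << p@_m *g encode m >>.
Proof.
rewrite /encode_alg /subst mmapE; apply: eq_bigr => m _.
have -> : fmprod (fun i => << FMonom (w i) >> : freealg R J) m = << encode m >>.
  rewrite /fmprod /encode; elim: (fmonom_val m) => [|i s IHs] /=.
    by rewrite big_nil -fmoneE.
  rewrite big_cons {}IHs malgM_def fgmulUU mulr1; congr << _ >>.
  by apply: fmonom_inj; rewrite fmM.
by rewrite malgM_def fgmulUU mulr1 mul1m.
Qed.

Lemma mcoeff_encode_alg p m : injective encode ->
  (encode_alg p)@_(encode m) = p@_m.
Proof.
move=> enc_inj; rewrite encode_algE raddf_sum /= [in RHS](monalgE p) raddf_sum.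
by apply: eq_bigr => k _; rewrite /= !mcoeffU (inj_eq enc_inj).
Qed.

Lemma encode_alg_inj : injective encode -> injective encode_alg.
Proof.
move=> enc_inj p q epq; apply/malgP => m.
by rewrite -!(mcoeff_encode_alg _ _ enc_inj) epq.
Qed.

Lemma msupp_encode_alg p k : k \in msupp (encode_alg p) ->
  exists2 m, m \in msupp p & k = encode m.
Proof.
rewrite -mcoeff_neq0 encode_algE raddf_sum /= => nz.
have [/hasP[m mp /eqP ->]|/hasPn noenc] :=
    boolP (has (fun m => k == encode m) (msupp p)); first by exists m.
case/eqP: nz; apply: big1_seq => m /andP[_ /noenc ne].
by rewrite mcoeffU eq_sym (negPf ne).
Qed.

Lemma encode_alg_surj p : (forall k, k \in msupp p -> exists m, k = encode m) ->
  exists q, encode_alg q = p.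
Proof.
move=> sp; rewrite [p]monalgE big_seq; elim/big_ind: _ => [|_ _ [q1 <-] [q2 <-]|].
- by exists 0; rewrite raddf0.
- by exists (q1 + q2); rewrite raddfD.
move=> k /sp[m ek]; exists (<< p@_k *g m >>).
rewrite encode_algE msuppU; case: eqP => [->|_].
  by rewrite big_nil monalgU0.
by rewrite big_seq_fset1 mcoeffUU ek.
Qed.

End Encoding.

(** The hypotheses make [w] a prefix code: the first letter can be read off and its code word
    cancelled. Nonempty code words keep the empty word apart from all others. *)
Lemma encode_inj (I J : choiceType) (w : I -> seq J) :
  (forall i, w i <> [::]) ->
  (forall i j s t, w i ++ s = w j ++ t -> i = j) -> injective (encode w).
Proof.
move=> w0 wpref [s] [t] [e]; congr FMonom.
elim: s t e => [|i s IHs] [|j t] //=.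
- by case: (w j) (w0 j).
- by case: (w i) (w0 i).
move=> e; have eij := wpref _ _ _ _ e; rewrite eij in e *.
by move/eqP: e; rewrite eqseq_cat // eqxx => /eqP/IHs->.
Qed.

Lemma encode_algU (R : comNzRingType) (I J : choiceType) (w : I -> seq J)
    (m : {fmonom I}) :
  encode_alg w (<< m >> : freealg R I) = << encode w m >>.
Proof. by rewrite encode_algE msuppU oner_eq0 big_seq_fset1 mcoeffUU. Qed.

Lemma encode_alg_var (R : comNzRingType) (I J : choiceType) (w : I -> seq J) i :
  encode_alg w (var R i) = << FMonom (w i) >>.
Proof. exact: subst_var. Qed.

Lemma lrmorphism_freealg_ext (R : comNzRingType) (I J : choiceType)
    (psi1 psi2 : {lrmorphism freealg R I -> freealg R J}) :
  (forall i, psi1 (var R i) = psi2 (var R i)) -> psi1 =1 psi2.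
Proof.
by move=> e f; rewrite (subst_unique e) -(subst_unique (psi := psi2)).
Qed.

(** * Balanced words as a free monoid *)

Definition letter_sign (a : letter) : int := if a is lx then 1 else -1.

Lemma imbalanceE s : imbalance s = weight letter_sign s.
Proof.
rewrite /imbalance /weight; elim: s => [|a s IHs]; first by rewrite big_nil.
by rewrite big_cons -IHs /=; case: a => /=; lia.
Qed.

Lemma imbalance_cons a s : imbalance (a :: s) = letter_sign a + imbalance s.
Proof. by rewrite !imbalanceE /weight big_cons. Qed.

Lemma imbalance_cat s t : imbalance (s ++ t) = imbalance s + imbalance t.
Proof. by rewrite !imbalanceE weight_cat. Qed.

Lemma imbalance_swap s : imbalance (map swap s) = - imbalance s.
Proof.
elim: s => [|a s IHs] //=; rewrite !imbalance_cons IHs.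
by case: a => /=; lia.
Qed.

Lemma swapK : involutive swap. Proof. by case. Qed.

Lemma barM (m1 m2 : word) : bar (mmul m1 m2) = mmul (bar m1) (bar m2).
Proof. by apply: fmonom_inj; rewrite /= !fmM map_cat. Qed.

(** Presents [bar] as an encoding, so that it extends to an algebra endomorphism. *)
Lemma encode_swap (m : word) : encode (fun a => [:: swap a]) m = bar m.
Proof. by apply: fmonom_inj => /=; elim: (fmonom_val m) => //= a s ->. Qed.

Lemma barK : involutive bar.
Proof. by move=> m; apply: fmonom_inj => /=; apply/mapK/swapK. Qed.

(* [(i, false)] stands for [u i] and [(i, true)] for [bar (u i)]. *)
Definition prime_word (p : nat * bool) : seq letter :=
  if p.2 then bar (u p.1) else u p.1.

Lemma min_balanced_u i : min_balanced (u i).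
Proof. by apply/u_enum; exists i. Qed.

Lemma u_inj : injective u.
Proof.
move=> i j e; have [ltij|ltji|//] := ltngtP i j.
  by have := u_increasing ltij; rewrite e prec_irr.
by have := u_increasing ltji; rewrite e prec_irr.
Qed.

Lemma u_prefix i k : (0 < k < size (u i))%N -> 0 < imbalance (take k (u i)).
Proof.
case/and3P: (min_balanced_u i) => _ _ /forallP pos /andP[k0 ks].
by have := pos (Ordinal (ks : (k < fdeg (u i))%N)); rewrite /= k0.
Qed.

Lemma imbalance_u i : imbalance (u i) = 0.
Proof. by case/and3P: (min_balanced_u i) => _ /eqP. Qed.

(** A leading [ly] would be either a proper prefix of negative imbalance or the whole word, which is
    balanced. *)
Lemma u_head i : exists s, u i = lx :: s :> seq letter.
Proof.
have := imbalance_u i; have := @u_prefix i 1.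
have /and3P[+ _ _] := min_balanced_u i.
case: (u i) => -[|[] s] /=; first by rewrite -fdeg_eq0.
  by exists s.
case: s => [|b s] _ /=; first by rewrite imbalance_cons.
by move=> /(_ isT); rewrite /imbalance.
Qed.

Lemma prime_word_neq0 p : prime_word p <> [::].
Proof.
by case: p => i [] /=; case: (u_head i) => s e; rewrite /prime_word /= e.
Qed.

Lemma imbalance_prime_word p : imbalance (prime_word p) = 0.
Proof.
case: p => i [] /=; rewrite /prime_word /= ?imbalance_swap imbalance_u //.
Qed.

Lemma prime_word_prefix p k : (0 < k < size (prime_word p))%N ->
  imbalance (take k (prime_word p)) != 0.
Proof.
case: p => i [] /=; rewrite /prime_word /= ?size_map => /u_prefix.
  by rewrite -map_take imbalance_swap oppr_eq0; apply: lt0r_neq0.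
exact: lt0r_neq0.
Qed.

(** The first letter, [lx] for [u i] and [ly] for its swap, determines the boolean; injectivity of
    [u] does the rest. *)
Lemma prime_word_inj : injective prime_word.
Proof.
move=> [i b] [j c]; rewrite /prime_word.
case: (u_head i) (u_head j) => s es [t et].
case: b c => [] [] /=; rewrite ?es ?et //= -?es -?et => e.
- case: e => /(inj_map (inv_inj swapK)) e.
  suff /u_inj-> : u i = u j by [].
  by apply: fmonom_inj; rewrite es et e.
by have /u_inj-> := fmonom_inj e.
Qed.

(** Otherwise the shorter of the two words would be a balanced, nonempty proper prefix of the
    longer, against [prime_word_prefix]. *)
Lemma prime_word_code p q s t :
  prime_word p ++ s = prime_word q ++ t -> p = q.
Proof.
wlog le_pq : p q s t / (size (prime_word p) <= size (prime_word q))%N.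
  move=> wl e; have [le_pq|/ltnW le_qp] := leqP (size (prime_word p))
    (size (prime_word q)); first exact: wl e.
  exact/esym/(wl _ _ t s).
move=> e; apply: prime_word_inj.
have := congr1 (take (size (prime_word p))) e.
rewrite take_size_cat // take_cat ltn_neqAle le_pq andbT.
case: eqP => [ns|/eqP ne] /=.
  by rewrite ns subnn take0 cats0.
move=> ep; have := @prime_word_prefix q (size (prime_word p)).
rewrite -ep imbalance_prime_word eqxx [X in _ && X]ltn_neqAle ne le_pq.
by case: (prime_word p) (@prime_word_neq0 p) => // a r _ /(_ isT).
Qed.

Lemma encode_prime_word_inj : injective (encode prime_word).
Proof. exact: encode_inj prime_word_neq0 prime_word_code. Qed.

(** A discrete continuity property: the imbalance of prefixes cannot pass from positive to negative
    without vanishing. *)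
Lemma imbalance_take_step s k : (k < size s)%N ->
  imbalance (take k s) - 1 <= imbalance (take k.+1 s).
Proof.
move=> ks; rewrite (take_nth lx ks) -cats1 imbalance_cat.
by rewrite lerD2l /imbalance; case: (nth _ _ _).
Qed.

(** Cut at the first return of the imbalance to zero. It starts at 1 and stays positive before that
    point, so the part cut off is minimally balanced. *)
Lemma split_u s : imbalance (lx :: s) = 0 ->
  exists i t, lx :: s = u i ++ t.
Proof.
move=> s0; pose P k := (0 < k)%N && (imbalance (take k (lx :: s)) == 0).
have exP : exists k, P k.
  by exists (size s).+1; rewrite /P /= take_size s0.
case: (ex_minnP exP) => k /andP[k0 /eqP ek] mink.
have ks : (k <= (size s).+1)%N by apply: mink; rewrite /P /= take_size s0.
have pos j : (0 < j < k)%N -> 0 < imbalance (take j (lx :: s)).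
  elim: j => // -[|j] IHj ltjk; first by rewrite /= take0.
  have jk : (j.+2 < k)%N by [].
  have js : (j.+1 < size (lx :: s))%N by rewrite /=; lia.
  have := imbalance_take_step js; have := IHj (ltnW jk).
  have : imbalance (take j.+2 (lx :: s)) != 0.
    by apply: contraL jk => e0; rewrite -leqNgt; apply: mink; rewrite /P e0.
  by lia.
have [|i ei] := (u_enum (FMonom (take k (lx :: s)))).1.
  apply/and3P; split.
  - by case: k k0 {ek mink ks pos} => // k _; rewrite -fdeg_eq0.
  - exact/eqP.
  apply/forallP => -[j /=]; rewrite /fdeg /= size_take /= => ltj.
  have jk : (j < k)%N by move: ltj; case: ifP; lia.
  by apply/implyP => j0; rewrite take_takel ?(ltnW jk) ?pos ?j0.
by exists i, (drop k (lx :: s)); rewrite -ei cat_take_drop.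
Qed.

(** Strong induction on the length, stripping one prime word from the front. *)
Lemma balanced_encode s : imbalance s = 0 ->
  exists m, FMonom s = encode prime_word m.
Proof.
have [k] := ubnP (size s); elim: k s => // k IHk s lesk s0.
suff [->|[p [t es]]] : s = [::] \/ exists p t, s = prime_word p ++ t.
- by exists mone; apply: fmonom_inj; rewrite /encode fm1.
- have ltts : (size t < size s)%N.
    rewrite es size_cat; case: (prime_word p) (@prime_word_neq0 p) => //= *.
    by rewrite addSn ltnS leq_addl.
  have [|//|m em] := IHk t; first exact: leq_trans ltts _.
    by move: s0; rewrite es imbalance_cat imbalance_prime_word add0r.
  exists (mmul (fmu p) m); apply: fmonom_inj.
  by rewrite /= fmM fmU es /=; case: em => <-.
case: s s0 {lesk} => [|[] s] s0; [by left|right..].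
  by have [i [t ->]] := split_u s0; exists (i, false), t.
(* A word beginning with [ly] is swapped, split by [split_u], and swapped back. *)
have : imbalance (lx :: map swap s) = 0.
  by have := imbalance_swap (ly :: s); rewrite s0 oppr0.
move/split_u=> [i [t e]]; exists (i, true), (map swap t).
by rewrite /prime_word /= -map_cat -e /= mapK //; apply: swapK.
Qed.

(** * The bar symmetry and the triangular change of variables *)

Section BivariateImage.
Variable F : fieldType.

Lemma bar_invariant_factors (g h : freealg F letter) k :
  g != 0 -> h != 0 ->
  (forall m, m \in msupp (g * h) -> bar m \in msupp (g * h)) ->
  (forall m, m \in msupp g -> imbalance m = k) -> k = 0.
Proof.
move=> g0 h0 gh_bar gk.
(* The constant weight 1 measures length, so [m1] and [m2] are longest monomials. *)
have [m1 [m2 [m1g m2h m12 max1 max2]]] := msupp_mul_max (fun _ => 1) g0 h0.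
have weight1 (m : seq letter) : weight (fun _ => 1) m = (size m)%:Z.
  by rewrite /weight big_const_seq count_predT; elim: (size m) => //= j ->; lia.
have [k1 [k2 [k1g k2h]]] := msuppM_le (gh_bar _ m12).
rewrite barM => /(congr1 (@fmonom_val _)); rewrite !fmM => e.
have le1 : (size k1 <= size m1)%N by have := max1 _ k1g; rewrite !weight1.
have le2 : (size k2 <= size m2)%N by have := max2 _ k2h; rewrite !weight1.
have sz : (size m1 + size m2 = size k1 + size k2)%N.
  by have := congr1 size e; rewrite !size_cat /= !size_map.
have sz1 : size m1 = size k1 by lia.
have {}sz1 : size (map swap m1) = size k1 by rewrite size_map.
move/eqP: e; rewrite eqseq_cat // => /andP[/eqP e1 _].
(* Both [m1] and its swap [k1] occur in [g], whence [k = - k]. *)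
by have := gk _ m1g; have := gk _ k1g; rewrite -e1 imbalance_swap; lia.
Qed.

(** An elementary automorphism. The scalar [sgn] is kept as a parameter so that the inverse is the
    shear with the opposite scalar. *)
Definition shear (sgn : F) :
    freealg F (nat * bool)%type -> freealg F (nat * bool)%type :=
  subst (fun p => if p.2 then var F p else var F p + sgn *: var F (p.1, true)).

HB.instance Definition _ (sgn : F) := GRing.LRMorphism.copy (shear sgn)
  (subst (fun p : nat * bool =>
    if p.2 then var F p else var F p + sgn *: var F (p.1, true))).

Lemma shear_var sgn i b : shear sgn (var F (i, b)) =
  if b then var F (i, b) else var F (i, b) + sgn *: var F (i, true).
Proof. exact: subst_var. Qed.

Lemma shearM sgn : {morph shear sgn : p q / p * q}.
Proof. exact: rmorphM. Qed.

Lemma shearK sgn : cancel (shear sgn) (shear (- sgn)).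
Proof.
apply: (@lrmorphism_freealg_ext _ _ _ (shear (- sgn) \o shear sgn) idfun).
move=> [i []] /=; rewrite !shear_var // raddfD /= linearZ /= !shear_var.
by rewrite scaleNr subrK.
Qed.

Variable n : nat.

Definition plain_letter (i : 'I_n) : seq (nat * bool) := [:: (val i, false)].

Lemma encode_plain_letter_inj : injective (encode plain_letter).
Proof. by apply: encode_inj => // i j s t [/val_inj]. Qed.

(** Factors [phi] into an inclusion of free letters, an automorphism, and an injective encoding; it
    suffices to compare values on the variables. *)
Lemma phiE (f : freealg F 'I_n) :
  phi f = encode_alg prime_word (shear 1 (encode_alg plain_letter f)).
Proof.
move: f; apply: (@lrmorphism_freealg_ext _ _ _ (@phi F n)
  (encode_alg prime_word \o (shear 1 \o encode_alg plain_letter))) => i /=.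
rewrite phi_var encode_alg_var -[<< FMonom _ >>]/(<< FMonom [:: _] >>) -fmuE.
rewrite -/(var F _) shear_var raddfD scale1r /= !encode_alg_var.
by rewrite /prime_word /= fmK.
Qed.

(** The endomorphism induced by [swap] exchanges the two terms of each [phi (var F i)], hence fixes
    the image of [phi] pointwise. *)
Lemma phi_bar (f : freealg F 'I_n) m :
  m \in msupp (phi f) -> bar m \in msupp (phi f).
Proof.
have sigma_phi : encode_alg (fun a => [:: swap a]) (phi f) = phi f.
  move: f; apply: (@lrmorphism_freealg_ext _ _ _
    (encode_alg (fun a => [:: swap a]) \o @phi F n) (@phi F n)) => i /=.
  by rewrite phi_var encode_algD 2!encode_algU 2!encode_swap barK addrC.
rewrite -!mcoeff_neq0 -{2}sigma_phi -encode_swap mcoeff_encode_alg //.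
by move=> m1 m2; rewrite !encode_swap => /(inv_inj barK).
Qed.

End BivariateImage.

(** * Descending the factors to the source of [phi] *)

Lemma deg_neq0 (F : fieldType) (I : choiceType) (g : freealg F I) :
  (0 < deg g)%N -> g != 0.
Proof. by apply: contraTneq => ->; rewrite /deg mmeasure0. Qed.

Lemma phi_not_const (F : fieldType) (n : nat) (g : freealg F 'I_n) :
  (0 < deg (phi g))%N -> forall c : F, g <> c%:MP.
Proof.
move=> dg c eg; move: dg; rewrite eg /phi /subst mmapC /deg mmeasureC.
by case: (c != 0).
Qed.

Lemma balanced_encode_alg (F : fieldType) (g : freealg F letter) :
  (forall m, m \in msupp g -> imbalance m = 0) ->
  exists G, g = encode_alg prime_word G.
Proof.
move=> g0; have [|G <-] := @encode_alg_surj _ _ _ prime_word g; last by exists G.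
by move=> m /g0/balanced_encode; rewrite fmK.
Qed.

(** The associated weight counts the letters outside the image of [plain_letter]. Being nonnegative,
    it vanishes exactly on words in the [n] plain letters. *)
Definition foreign_letter (n : nat) (p : nat * bool) : int :=
  (p.2 || (n <= p.1)%N)%:R.

Lemma foreign_letter_ge0 n s : 0 <= weight (foreign_letter n) s.
Proof. by apply: sumr_ge0 => p _; rewrite /foreign_letter; case: (_ || _). Qed.

Lemma weight_foreign_eq0 n s : weight (foreign_letter n) s = 0 ->
  exists m, FMonom s = encode (@plain_letter n) m.
Proof.
elim: s => [|[i b] s IHs].
  by exists mone; apply: fmonom_inj; rewrite /encode fm1.
have := foreign_letter_ge0 n s; rewrite /weight big_cons -/(weight _ _).
rewrite {2}/foreign_letter /=; case: b => /=; first by lia.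
case: leqP => [|ltin] /=; first by lia.
rewrite add0r => _ /IHs[m em]; exists (mmul (fmu (Ordinal ltin)) m).
by apply: fmonom_inj; rewrite /= fmM fmU /=; case: em => ->.
Qed.

Lemma plain_encode_alg (F : fieldType) n (G : freealg F (nat * bool)%type) :
  (forall m, m \in msupp G -> weight (foreign_letter n) m = 0) ->
  exists g, G = encode_alg (@plain_letter n) g.
Proof.
move=> G0.
have [|g <-] := @encode_alg_surj _ _ _ (@plain_letter n) G; last by exists g.
by move=> m /G0/weight_foreign_eq0; rewrite fmK.
Qed.

Lemma weight_plain n m :
  weight (foreign_letter n) (encode (@plain_letter n) m) = 0.
Proof.
rewrite /weight /=; elim: (fmonom_val m) => [|i s IHs]; first by rewrite big_nil.
by rewrite /= big_cons IHs /foreign_letter /= leqNgt ltn_ord.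
Qed.

Theorem mainTheorem4 (F : fieldType) (n : nat)
    (f : freealg F 'I_n) (g' h' : freealg F letter) :
  phi f = g' * h' -> (0 < deg g')%N -> (0 < deg h')%N ->
  exists g h : freealg F 'I_n,
    [/\ (forall c : F, g <> c%:MP), (forall c : F, h <> c%:MP),
        g' = phi g, h' = phi h & f = g * h].
Proof.
move=> fgh dg dh; have g0 := deg_neq0 dg; have h0 := deg_neq0 dh.
have gh_bal m : m \in msupp (g' * h') -> weight letter_sign m = 0.
  rewrite -fgh phiE => /msupp_encode_alg[k _ ->]; rewrite -imbalanceE.
  rewrite /=; elim: (fmonom_val k) => //= p s IHs.
  by rewrite imbalance_cat IHs imbalance_prime_word.
have [k [gk hk]] := homogeneous_factors g0 h0 gh_bal.
have gk' m : m \in msupp g' -> imbalance m = k by rewrite imbalanceE => /gk.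
have k0 : k = 0.
  by apply: (bar_invariant_factors g0 h0) gk' => m; rewrite -fgh; apply: phi_bar.
have [G eG] : exists G, g' = encode_alg prime_word G.
  by apply: balanced_encode_alg => m /gk'->.
have [H eH] : exists H, h' = encode_alg prime_word H.
  by apply: balanced_encode_alg => m /hk; rewrite -imbalanceE k0 oppr0.
have shearNK : cancel (shear (- 1 : F)) (shear 1).
  by move=> p; rewrite -[X in shear X]opprK shearK.
(* Removing the encoding and then the shear turns the given factorization into one of [f] itself,
   among polynomials in all letters. *)
have efGH : encode_alg (@plain_letter n) f = shear (- 1) G * shear (- 1) H.
  rewrite -shearM -[LHS](shearK 1); congr (shear _ _).
  apply: (encode_alg_inj encode_prime_word_inj).
  rewrite -phiE fgh eG eH.
  exact/esym/encode_algM.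
have sG0 : shear (- 1) G != 0.
  by apply: contraNneq g0 => e; rewrite eG -(shearNK G) e !raddf0.
have sH0 : shear (- 1) H != 0.
  by apply: contraNneq h0 => e; rewrite eH -(shearNK H) e !raddf0.
have [|j [Gj Hj]] := homogeneous_factors (d := foreign_letter n) sG0 sH0.
  by move=> m; rewrite -efGH => /msupp_encode_alg[m' _ ->]; apply: weight_plain.
(* Any monomials of the two factors would do: their counts of foreign letters are [j] and [- j],
   both nonnegative. *)
have [m1 [m2 [m1G m2H _ _ _]]] := msupp_mul_max (foreign_letter n) sG0 sH0.
have j0 : j = 0.
  have := foreign_letter_ge0 n m1; have := foreign_letter_ge0 n m2.
  by rewrite (Gj _ m1G) (Hj _ m2H); lia.
have [g eg] : exists g, shear (- 1) G = encode_alg (@plain_letter n) g.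
  by apply: plain_encode_alg => m /Gj->.
have [h eh] : exists h, shear (- 1) H = encode_alg (@plain_letter n) h.
  by apply: plain_encode_alg => m /Hj->; rewrite j0 oppr0.
have egg : g' = phi g by rewrite phiE -eg shearNK.
have ehh : h' = phi h by rewrite phiE -eh shearNK.
exists g, h; split=> //.
- by apply: phi_not_const; rewrite -egg.
- by apply: phi_not_const; rewrite -ehh.
apply: (encode_alg_inj (@encode_plain_letter_inj n)).
by rewrite efGH eg eh; apply/esym/encode_algM.
Qed.
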